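(* Let $(\mathfrak g,R)$ be a Rota-Baxter Lie algebra of weight $\lambda\in\mathbf k$ in characteristic $p>0$, and let $(\mathrm U_{\mathrm{RB}}(\mathfrak g),R)$ be the universal enveloping Rota-Baxter associative algebra of $(\mathfrak g,R)$. Then $(\mathrm U_{\mathrm{RB}}(\mathfrak g)^-,(-)^p,R)$, where $\mathrm U_{\mathrm{RB}}(\mathfrak g)^-$ is the commutator Lie algebra and $(-)^p$ the $p$-th power map, is a restricted Rota-Baxter Lie algebra of weight $\lambda$.
   Context: Convention: $\mathbf k$ is an algebraically closed field of prime characteristic $p$; everything is over $\mathbf k$. A Rota-Baxter (associative) algebra of weight $\lambda$ is an associative algebra $A$ with a linear map $P:A\to A$ such that $P(x)P(y)=P(P(x)y)+P(xP(y))+\lambda P(xy)$. A Rota-Baxter Lie algebra of weight $\lambda$ is a Lie algebra with a linear map $R$ such that $[R(x),R(y)]=R([R(x),y])+R([x,R(y)])+\lambda R([x,y])$. For a Rota-Baxter algebra $(A,P)$, $(A^-,P)$ with $A^-$ the commutator Lie algebra is a Rota-Baxter Lie algebra of the same weight. The universal enveloping Rota-Baxter associative algebra $(\mathrm U_{\mathrm{RB}}(\mathfrak g),R)$ of $(\mathfrak g,R)$ is a Rota-Baxter algebra of weight $\lambda$ with a Rota-Baxter Lie algebra homomorphism $\mathfrak g\to\mathrm U_{\mathrm{RB}}(\mathfrak g)^-$ that is universal among Rota-Baxter Lie algebra homomorphisms from $\mathfrak g$ to $A^-$ with $(A,P)$ a Rota-Baxter algebra of weight $\lambda$ (i.e.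 the left adjoint of $(A,P)\mapsto(A^-,P)$). Restricted Lie algebra: a Lie algebra $(\mathfrak g,[-,-])$ with a $p$-map $(-)^{[p]}:\mathfrak g\to\mathfrak g$ satisfying $(ax)^{[p]}=a^px^{[p]}$ for $a\in\mathbf k$, $[x^{[p]},y]=(\mathrm{ad}_x)^p(y)$, and $(x+y)^{[p]}=x^{[p]}+y^{[p]}+\sum_{i=1}^{p-1}s_i(x,y)$, where $i\,s_i(x,y)$ is the coefficient of $t^{i-1}$ in $(\mathrm{ad}_{tx+y})^{p-1}(x)\in\mathbf k[t]\otimes\mathfrak g$. For a composition $\alpha=(\alpha_1,\dots,\alpha_r)\vDash n$ (a tuple of positive integers with sum $n$, of length $\ell(\alpha)=r$), $C_\alpha=\prod_{k=1}^r\binom{\alpha_1+\cdots+\alpha_k-1}{\alpha_k-1}$. A restricted Rota-Baxter Lie algebra $(\mathfrak g,[-,-],(-)^{[p]},R)$ of weight $\lambda$ is a restricted Lie algebra with a Rota-Baxter operator $R$ of weight $\lambda$ such that $R(x^{[p]_R})=R(x)^{[p]}$ for all $x$, where, with $x\rhd_Ry:=[R(x),y]$ and $x^{\rhd_Rk}:=x\rhd_R(x\rhd_R\cdots(x\rhd_Rx)\cdots)$ ($k$ copies of $x$, $x^{\rhd_R1}=x$), $$x^{[p]_R}:=\lambda^{p-1}x^{[p]}+\sum_{r=1}^{p-1}\frac1r\lambda^{r-1}\sum_{\alpha\vDash p,\ \ell(\alpha)=r}C_\alpha\,[x^{\rhd_R\alpha_1},[x^{\rhd_R\alpha_2},[\cdots[x^{\rhd_R\alpha_{r-1}},x^{\rhd_R\alpha_r}]\cdots]]]$$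 ($\lambda^0=1$; $\frac1r$ is the inverse of $r$ modulo $p$). *)

(* Defs.v *)
From HB Require Import structures.
From mathcomp Require Import all_boot all_order all_algebra.
Set Implicit Arguments.
Unset Strict Implicit.
Unset Printing Implicit Defensive.
Import GRing.Theory.
Local Open Scope ring_scope.

Definition bilinear_op (k : fieldType) (V : lmodType k) (op : V -> V -> V) : Prop :=
  (forall x, linear (op x)) /\ (forall y, linear (op^~ y)).

Record lie_algebra (k : fieldType) (g : lmodType k) (br : g -> g -> g) : Prop := {
  lie_bilinear : bilinear_op br;
  lie_alternating : forall x, br x x = 0;
  lie_jacobi : forall x y z, br x (br y z) + br y (br z x) + br z (br x y) = 0
}.

(* Algebras need not be unital here; units are handled separately below. *)
Record assoc_algebra (k : fieldType) (A : lmodType k) (mul : A -> A -> A) : Prop := {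
  assoc_bilinear : bilinear_op mul;
  assoc_associative : associative mul
}.

(* [rb_operator lam op P] is used both with an associative product and with a
   Lie bracket. *)
Record rb_operator (k : fieldType) (lam : k) (V : lmodType k)
    (op : V -> V -> V) (P : V -> V) : Prop := {
  rb_linear : linear P;
  rb_identity : forall x y,
    op (P x) (P y) = P (op (P x) y) + P (op x (P y)) + lam *: P (op x y)
}.

Definition rb_algebra (k : fieldType) (lam : k) (A : lmodType k)
    (mul : A -> A -> A) (P : A -> A) : Prop :=
  assoc_algebra mul /\ rb_operator lam mul P.

Definition rb_lie_algebra (k : fieldType) (lam : k) (g : lmodType k)
    (br : g -> g -> g) (R : g -> g) : Prop :=
  lie_algebra br /\ rb_operator lam br R.

Definition commutator (V : zmodType) (mul : V -> V -> V) (x y : V) : V :=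
  mul x y - mul y x.

(* Homomorphisms of Rota-Baxter algebras (op, op' products) and of Rota-Baxter
   Lie algebras (op, op' brackets). *)
Record rb_hom (k : fieldType) (V W : lmodType k)
    (op : V -> V -> V) (P : V -> V) (op' : W -> W -> W) (P' : W -> W)
    (f : V -> W) : Prop := {
  rb_hom_linear : linear f;
  rb_hom_op : forall x y, f (op x y) = op' (f x) (f y);
  rb_hom_operator : forall x, f (P x) = P' (f x)
}.

Definition universal_enveloping_rb (k : fieldType) (lam : k)
    (g : lmodType k) (br : g -> g -> g) (R : g -> g)
    (U : lmodType k) (mul : U -> U -> U) (P : U -> U) (i : g -> U) : Prop :=
  [/\ rb_algebra lam mul P,
      rb_hom br R (commutator mul) P i
    & forall (A : lmodType k) (mulA : A -> A -> A) (PA : A -> A),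
        rb_algebra lam mulA PA ->
      forall f : g -> A, rb_hom br R (commutator mulA) PA f ->
      exists h : U -> A,
        [/\ rb_hom mul P mulA PA h,
            forall x, h (i x) = f x
          & forall h' : U -> A, rb_hom mul P mulA PA h' ->
              (forall x, h' (i x) = f x) -> h' =1 h]].

(* The same universal property in the category of unital Rota-Baxter algebras
   and unit-preserving homomorphisms. *)
Definition unital_universal_enveloping_rb (k : fieldType) (lam : k)
    (g : lmodType k) (br : g -> g -> g) (R : g -> g)
    (U : lmodType k) (mul : U -> U -> U) (e : U) (P : U -> U) (i : g -> U) : Prop :=
  [/\ rb_algebra lam mul P,
      left_id e mul /\ right_id e mul,
      rb_hom br R (commutator mul) P i
    & forall (A : lmodType k) (mulA : A -> A -> A) (eA : A) (PA : A -> A),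
        rb_algebra lam mulA PA -> left_id eA mulA /\ right_id eA mulA ->
      forall f : g -> A, rb_hom br R (commutator mulA) PA f ->
      exists h : U -> A,
        [/\ rb_hom mul P mulA PA h, h e = eA,
            forall x, h (i x) = f x
          & forall h' : U -> A, rb_hom mul P mulA PA h' -> h' e = eA ->
              (forall x, h' (i x) = f x) -> h' =1 h]].

(* n >= 1 factors, as there is no unit; the value at n = 0 is irrelevant. *)
Definition mul_pow (V : Type) (mul : V -> V -> V) (n : nat) (x : V) : V :=
  iter n.-1 (mul x) x.

(* An element of k[t] (x) g is given by its sequence of coefficients
   nat -> g; the bracket of g is extended k[t]-bilinearly. *)
Definition poly_bracket (V : zmodType) (br : V -> V -> V) (f h : nat -> V) : nat -> V :=
  fun n => \sum_(j < n.+1) br (f j) (h (n - j)%N).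

Definition poly_const (V : zmodType) (x : V) : nat -> V :=
  fun n => if n is 0 then x else 0.

(* t x + y *)
Definition poly_affine (V : zmodType) (x y : V) : nat -> V :=
  fun n => match n with 0 => y | 1 => x | _ => 0 end.

Definition jacobson_s (k : fieldType) (p : nat) (g : lmodType k)
    (br : g -> g -> g) (i : nat) (x y : g) : g :=
  (i%:R)^-1 *:
    iter p.-1 (poly_bracket br (poly_affine x y)) (poly_const x) i.-1.

Record restricted_lie_algebra (k : fieldType) (p : nat) (g : lmodType k)
    (br : g -> g -> g) (pmap : g -> g) : Prop := {
  rl_lie : lie_algebra br;
  rl_scale : forall (a : k) x, pmap (a *: x) = a ^+ p *: pmap x;
  rl_ad : forall x y, br (pmap x) y = iter p (br x) y;
  rl_add : forall x y,
    pmap (x + y) = pmap x + pmap y + \sum_(1 <= i < p) jacobson_s p br i x y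
}.

Definition is_composition (n : nat) (s : seq nat) : bool :=
  (0%N \notin s) && (sumn s == n).

Definition comp_coef (s : seq nat) : nat :=
  (\prod_(j < size s) 'C((sumn (take j.+1 s)).-1, (nth 0 s j).-1))%N.

Definition rhd (V : Type) (br : V -> V -> V) (R : V -> V) (x y : V) : V :=
  br (R x) y.

(* x |> (x |> ... (x |> x)) with n >= 1 copies of x *)
Definition rhd_pow (V : Type) (br : V -> V -> V) (R : V -> V) (x : V) (n : nat) : V :=
  iter n.-1 (rhd br R x) x.

(* [x1, [x2, ... [x_(r-1), x_r]]]; it is x1 when r = 1. *)
Fixpoint nested_bracket (V : zmodType) (br : V -> V -> V) (s : seq V) : V :=
  match s with
  | [::] => 0
  | [:: x] => x
  | x :: s' => br x (nested_bracket br s')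
  end.

(* x^([p]_R). Parts of a composition of p are at most p, so the compositions of
   length r are among the r-tuples over 'I_p.+1. *)
Definition rb_pmap (k : fieldType) (p : nat) (lam : k) (g : lmodType k)
    (br : g -> g -> g) (pmap : g -> g) (R : g -> g) (x : g) : g :=
  lam ^+ p.-1 *: pmap x +
  \sum_(1 <= r < p) ((r%:R)^-1 * lam ^+ r.-1) *:
    \sum_(a : r.-tuple 'I_p.+1 | is_composition p (map val a))
      (comp_coef (map val a))%:R *:
        nested_bracket br (map (rhd_pow br R x) (map val a)).

Record restricted_rb_lie_algebra (k : fieldType) (p : nat) (lam : k)
    (g : lmodType k) (br : g -> g -> g) (pmap : g -> g) (R : g -> g) : Prop := {
  rrb_restricted : restricted_lie_algebra p br pmap;
  rrb_operator : rb_operator lam br R;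
  rrb_pmap : forall x, R (rb_pmap p lam br pmap R x) = pmap (R x)
}.

(* Main.v *)
Require Import Defs.
From HB Require Import structures.
From mathcomp Require Import all_boot all_order all_algebra.
Import GRing.Theory.
Local Open Scope ring_scope.

(* The conclusion holds for every Rota-Baxter algebra (A, P) in characteristic p.
   The product x * y = P(x) y + x P(y) + lam x y makes P multiplicative, so
   P(x)^p = P(w_p) with w_n the n-th *-power of x.  With a = P(x), the recursion
   for w_n is that of ((a + t x)^n - a^n) / t at t = lam, and Jacobson's formula
   for (t x + a)^p gives w_p = lam^(p-1) x^p + sum_r lam^(r-1) s_r(x, a).
   Finally r s_r(x, a), the coefficient of t^(r-1) in (ad a + t ad x)^(p-1) x,
   is expanded over compositions of p: ad a is a derivation, and the
   coefficients C_alpha satisfy the matching Pascal-type recursion. *)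

Set Implicit Arguments.
Unset Strict Implicit.
Unset Printing Implicit Defensive.

(** * Derivatives of powers and iterated commutators in characteristic p *)

Section PowerCommutator.
Variables (E : nzRingType) (y x : E) (W : nat -> E).
Hypothesis W0 : W 0 = 0.
Hypothesis WS : forall n, W n.+1 = y * W n + x * y ^+ n.

Local Notation ad := (commutator *%R y).

(** The recursion makes [W n] the sum of all y^i x y^(n-1-i), so its commutator with y
    telescopes. *)
Lemma commutator_expr n : y ^+ n * x - x * y ^+ n = y * W n - W n * y.
Proof.
elim: n => [|n IHn]; first by rewrite W0 mulr0 mul0r expr0 mul1r mulr1 !subrr.
rewrite WS mulrDr mulrDl opprD -[x * y ^+ n * y]mulrA -exprSr addrACA.
by rewrite -[y * W n * y]mulrA -mulrBr -IHn mulrBr addrA subrK mulrA -exprS.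
Qed.

(** Moving y to the right by y z = ad z + z y raises either the depth of [ad] or the exponent of y;
    Pascal's rule collects the two contributions. *)
Lemma power_sum_ad n :
  W n = \sum_(i < n) (iter i ad x * y ^+ (n.-1 - i)) *+ 'C(n, i.+1).
Proof.
elim: n => [|n IHn]; first by rewrite W0 big_ord0.
have yad i : y * iter i ad x = iter i.+1 ad x + iter i ad x * y.
  by rewrite iterS /commutator subrK.
rewrite WS {}IHn mulr_sumr.
under eq_bigr => i _.
  rewrite mulrnAr mulrA yad mulrDl mulrnDl -mulrA -exprS.
  have -> : (n.-1 - i).+1 = (n - i)%N by case: n i => [[]|n i] //=; rewrite subSn // -ltnS.
  over.
rewrite big_split /= [RHS](_ : _ = \sum_(i < n.+1) (iter i ad x * y ^+ (n - i)) *+ 'C(n, i.+1)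
  + \sum_(i < n.+1) (iter i ad x * y ^+ (n - i)) *+ 'C(n, i)); last first.
  by rewrite -big_split; apply: eq_bigr => i _; rewrite /= binS mulrnDr.
rewrite big_ord_recr /= bin_small // mulr0n addr0.
rewrite [X in _ = _ + X]big_ord_recl /= subn0 bin0 mulr1n.
rewrite [RHS]addrCA [LHS]addrC; congr (_ + _); rewrite [LHS]addrC; congr (_ + _).
apply: eq_bigr => i _; rewrite /bump /= add1n.
by congr (_ * y ^+ _ *+ _); case: n i => [[]|n i] //=; rewrite subSS.
Qed.

Variable p : nat.
Hypothesis charEp : p \in [pchar E].

(** In [power_sum_ad] every binomial except the last one, ['C(p, p)], is divisible by p. *)
Lemma power_sum_pchar : W p = iter p.-1 ad x.
Proof.
have pp := pcharf_prime charEp; rewrite power_sum_ad.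
case: p pp charEp => // q pp cE; rewrite big_ord_recr /= big1 ?add0r => [|i _].
  by rewrite subnn expr0 mulr1 binn.
have /dvdnP[c ->] : (q.+1 %| 'C(q.+1, i.+1))%N by apply: prime_dvd_bin; rewrite /= ?ltnS ?ltn_ord.
by rewrite mulrnA -mulr_natr (pcharf0 cE) mulr0.
Qed.

End PowerCommutator.

Lemma commutator_expr_pchar (E : nzRingType) p (charEp : p \in [pchar E]) (x y : E) :
  commutator *%R (y ^+ p) x = iter p (commutator *%R y) x.
Proof.
pose W := fix W n := if n is m.+1 then y * W m + x * y ^+ m else 0.
have pp := prime_gt0 (pcharf_prime charEp).
rewrite {1}/commutator (@commutator_expr _ y x W) // (@power_sum_pchar _ y x W _ _ p) //.
by rewrite -[in RHS](prednK pp).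
Qed.

(** * Jacobson's formula: the coefficients of (x t + y)^p *)

Section Jacobson.
Variables (E : nzRingType) (x y : E).
Local Notation Y := (x%:P * 'X + y%:P).

Lemma coef_affine n : Y`_n = poly_affine x y n.
Proof.
rewrite coefD coefMX !coefC; by case: n => [|[|n]] /=; rewrite ?add0r ?addr0.
Qed.

Lemma coef0_affine_exp n : (Y ^+ n)`_0 = y ^+ n.
Proof.
elim: n => [|n IHn]; first by rewrite !expr0 coef1.
by rewrite !exprS mulrDl coefD -mulrA -['X * _]commr_polyX mulrA coefMX /= coefCM add0r IHn.
Qed.

Lemma coefS_affine_expS n i :
  (Y ^+ n.+1)`_i.+1 = x * (Y ^+ n)`_i + y * (Y ^+ n)`_i.+1.
Proof. by rewrite exprS mulrDl coefD -mulrA -['X * _]commr_polyX mulrA coefMX !coefCM. Qed.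

Lemma size_affine_exp n : (size (Y ^+ n) <= n.+1)%N.
Proof.
apply/leq_sizeP; elim: n => [|n IHn] [|j] // lt_nj.
  by rewrite expr0 coef1.
by rewrite coefS_affine_expS !IHn ?mulr0 ?addr0 // ltnW.
Qed.

Lemma lead_affine_exp n : (Y ^+ n)`_n = x ^+ n.
Proof.
elim: n => [|n IHn]; first by rewrite expr0 coef1.
by rewrite coefS_affine_expS IHn (nth_default _ (size_affine_exp n)) mulr0 addr0 exprS.
Qed.

Lemma coef_iter_bracket n :
  iter n (poly_bracket (commutator *%R) (poly_affine x y)) (poly_const x) =1
  nth 0 (iter n (commutator *%R Y) x%:P).
Proof.
elim: n => [|n IHn] i /=; first by rewrite coefC; case: i.
rewrite /poly_bracket /commutator coefB coefM coefMr -sumrB.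
by apply: eq_bigr => j _; rewrite -coef_affine IHn.
Qed.

(** The formal derivative of [Y] is the constant x, so the derivatives of the powers of [Y] satisfy
    the recursion of [W] over the polynomial ring. Hence that of Y^p is ad_Y^(p-1) x. *)
Lemma coef_affine_exp_pchar p i : p \in [pchar E] ->
  (Y ^+ p)`_i.+1 *+ i.+1 =
  iter p.-1 (poly_bracket (commutator *%R) (poly_affine x y)) (poly_const x) i.
Proof.
move=> charEp; rewrite coef_iter_bracket -coef_deriv.
have charPp : p \in [pchar {poly E}] by rewrite pchar_poly.
congr (nth 0 (polyseq _) i); apply: (power_sum_pchar (W := fun n => (Y ^+ n)^`())) => // [|n].
  by rewrite expr0 derivC.
by rewrite exprS derivM derivD derivC derivM derivC derivX mul0r add0r mulr1 addr0 addrC.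
Qed.

(** Evaluation at 1 respects powers although E is noncommutative, because 1 is central. *)
Lemma expr_affine_sum n : (x + y) ^+ n = \sum_(i < n.+1) (Y ^+ n)`_i.
Proof.
have -> : (x + y) ^+ n = (Y ^+ n).[1].
  rewrite horner_exp_comm; last by rewrite /comm_poly mulr1 mul1r.
  by rewrite hornerD hornerMX !hornerC mulr1.
rewrite (horner_coef_wide _ (size_affine_exp n)).
by apply: eq_bigr => i _; rewrite expr1n mulr1.
Qed.
End Jacobson.

(** Pairs the terms of a double commutator so that their cyclic sum telescopes in the Jacobi
    identity. *)
Lemma subrB_swap (V : zmodType) (a b c d : V) : a - b - (c - d) = (a - c) + (d - b).
Proof. by rewrite opprB [d - c]addrC addrACA [- b + d]addrC. Qed.

(** * Adjoining a unit to an associative algebra *)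

Section Unitization.
Variables (k : fieldType) (A : lmodType k) (mul : A -> A -> A).

(** The algebra need not have a unit, whereas polynomials require a unital ring. The proof of
    [assoc_algebra mul] is an argument of the type so that the ring instance can depend on it. *)
Definition unitization of assoc_algebra mul : Type := (k * A)%type.

Hypothesis H : assoc_algebra mul.
Local Notation E := (unitization H).

HB.instance Definition _ := GRing.Zmodule.copy E (k * A)%type.

Definition unitization_mul (u v : E) : E :=
  (u.1 * v.1, u.1 *: v.2 + v.1 *: u.2 + mul u.2 v.2).

Lemma algDl u v w : mul (u + v) w = mul u w + mul v w.
Proof. by case: (assoc_bilinear H) => _ /(_ w) /(_ 1 u v); rewrite !scale1r. Qed.

Lemma algDr u v w : mul w (u + v) = mul w u + mul w v.
Proof. by case: (assoc_bilinear H) => /(_ w) /(_ 1 u v) + _; rewrite !scale1r. Qed.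

Lemma alg0l w : mul 0 w = 0.
Proof. by apply: (@addrI _ (mul 0 w)); rewrite -algDl !addr0. Qed.

Lemma alg0r w : mul w 0 = 0.
Proof. by apply: (@addrI _ (mul w 0)); rewrite -algDr !addr0. Qed.

Lemma algZl c u w : mul (c *: u) w = c *: mul u w.
Proof. by case: (assoc_bilinear H) => _ /(_ w) /(_ c u 0); rewrite !addr0 alg0l addr0. Qed.

Lemma algZr c u w : mul w (c *: u) = c *: mul w u.
Proof. by case: (assoc_bilinear H) => /(_ w) /(_ c u 0) + _; rewrite !addr0 alg0r addr0. Qed.

Lemma unitization_mulA : associative unitization_mul.
Proof.
move=> [a u] [b v] [c w]; rewrite /unitization_mul /= mulrA; congr pair.
rewrite !(algDl, algDr, algZl, algZr, scalerDr, scalerA) (assoc_associative H).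
rewrite [c * a]mulrC [c * b]mulrC -!addrA; congr (_ + (_ + _)).
by rewrite addrCA; congr (_ + _); rewrite [RHS]addrCA; congr (_ + _); rewrite addrCA.
Qed.

Lemma unitization_mul1l : left_id ((1, 0) : E) unitization_mul.
Proof. by case=> a u; rewrite /unitization_mul /= alg0l scaler0 scale1r mul1r !addr0. Qed.

Lemma unitization_mul1r : right_id ((1, 0) : E) unitization_mul.
Proof. by case=> a u; rewrite /unitization_mul /= alg0r scaler0 scale1r mulr1 add0r addr0. Qed.

Lemma unitization_mulDl : left_distributive unitization_mul +%R.
Proof.
move=> [a u] [b v] [c w]; congr pair; rewrite /= ?mulrDl //.
by rewrite algDl scalerDl scalerDr [RHS]addrACA; congr (_ + _); rewrite addrACA.
Qed.

Lemma unitization_mulDr : right_distributive unitization_mul +%R.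
Proof.
move=> [a u] [b v] [c w]; congr pair; rewrite /= ?mulrDr //.
by rewrite algDr scalerDl scalerDr [RHS]addrACA; congr (_ + _); rewrite addrACA.
Qed.

Lemma unitization_1neq0 : ((1, 0) : E) != 0.
Proof. by rewrite xpair_eqE oner_eq0. Qed.

HB.instance Definition _ := GRing.Zmodule_isNzRing.Build E unitization_mulA
  unitization_mul1l unitization_mul1r unitization_mulDl unitization_mulDr
  unitization_1neq0.

Definition unit_inj (u : A) : E := (0, u).
Local Notation iota := unit_inj.

Lemma unit_inj_inj : injective iota.
Proof. by move=> u v []. Qed.

Lemma unit_injD u v : iota (u + v) = iota u + iota v.
Proof. by congr pair; rewrite addr0. Qed.

Lemma unit_injB u v : iota (u - v) = iota u - iota v.
Proof. by congr pair; rewrite subr0. Qed.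

Lemma unit_injMn u n : iota (u *+ n) = iota u *+ n.
Proof. by elim: n => [|n IHn] //; rewrite !mulrSr unit_injD IHn. Qed.

Lemma unit_inj_sum (I : Type) (r : seq I) (Q : pred I) (F : I -> A) :
  iota (\sum_(i <- r | Q i) F i) = \sum_(i <- r | Q i) iota (F i).
Proof. exact: (big_morph iota unit_injD). Qed.

Lemma unit_injM u v : iota (mul u v) = iota u * iota v.
Proof. by congr pair; rewrite /= ?mul0r // !scale0r !add0r. Qed.

Lemma unit_injZ c u : iota (c *: u) = ((c, 0) : E) * iota u.
Proof. by congr pair; rewrite /= ?mulr0 // alg0l scale0r !addr0. Qed.

Lemma unit_scalar_comm c (z : E) : ((c, 0) : E) * z = z * ((c, 0) : E).
Proof.
case: z => a u; congr pair; rewrite /= 1?mulrC //.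
by rewrite alg0l alg0r [c *: u + _]addrC.
Qed.

Lemma unit_scalarM c d : ((c, 0) : E) * ((d, 0) : E) = (c * d, 0).
Proof. by congr pair; rewrite /= alg0l !scaler0 !addr0. Qed.

Lemma mul_powS n u : mul_pow mul n.+2 u = mul u (mul_pow mul n.+1 u).
Proof. by []. Qed.

Lemma unit_inj_pow n u : iota (mul_pow mul n.+1 u) = iota u ^+ n.+1.
Proof.
elim: n => [|n IHn]; first by rewrite expr1.
by rewrite exprS -IHn -unit_injM.
Qed.

Lemma unit_inj_commutator u v : iota (commutator mul u v) = commutator *%R (iota u) (iota v).
Proof. by rewrite unit_injB !unit_injM. Qed.

Lemma unit_inj_iter_ad n u v :
  iota (iter n (commutator mul u) v) = iter n (commutator *%R (iota u)) (iota v).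
Proof. by elim: n => //= n IHn; rewrite unit_inj_commutator IHn. Qed.

Lemma unit_inj_iter_bracket n u v i :
  iota (iter n (poly_bracket (commutator mul) (poly_affine u v)) (poly_const u) i) =
  iter n (poly_bracket (commutator *%R) (poly_affine (iota u) (iota v))) (poly_const (iota u)) i.
Proof.
elim: n i => [|n IHn] i; first by case: i.
rewrite !iterS /poly_bracket unit_inj_sum; apply: eq_bigr => j _.
by rewrite unit_inj_commutator IHn; case: (val j) => [|[|]].
Qed.

Lemma unitization_MnE (z : E) n : z *+ n = (z.1 *+ n, z.2 *+ n).
Proof. by elim: n => [|n IHn]; rewrite ?mulr0n // !mulrSr IHn. Qed.

Lemma unitization_pchar p : p \in [pchar k] -> p \in [pchar E].
Proof.
move=> charp; apply/andP; split; first exact: pcharf_prime charp.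
by rewrite unitization_MnE /= (pcharf0 charp) mul0rn.
Qed.

(** Replaces division by i in s_i, since E is given only a ring structure. *)
Lemma unitization_MnI n : n%:R != 0 :> k -> injective (fun z : E => z *+ n).
Proof.
move=> n0 [a u] [b v]; rewrite /= !unitization_MnE /= => -[].
rewrite -[a *+ n]mulr_natl -[b *+ n]mulr_natl => /(mulfI n0) ->.
by rewrite -!scaler_nat => /(scalerI n0) ->.
Qed.

Lemma commutator_lie : lie_algebra (commutator mul).
Proof.
split; first split=> [u c v w|w c u v].
1,2: by rewrite /commutator algDl algDr algZl algZr opprD addrACA scalerBr.
- by move=> u; rewrite /commutator subrr.
move=> u v w; apply: unit_inj_inj; rewrite 2!unit_injD !unit_inj_commutator.
rewrite /commutator !(mulrBl, mulrBr) !mulrA !subrB_swap.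
by rewrite [X in X + _ = _]addrACA !subrKA addrACA !subrKA !subrr addr0.
Qed.

(** * The p-th power map as a restricted structure on the commutator Lie algebra *)

Section Restricted.
Variable p : nat.
Hypothesis charp : p \in [pchar k].

Let natk_neq0 i : (0 < i < p)%N -> i%:R != 0 :> k.
Proof.
case/andP=> i0 ip; rewrite -(dvdn_pcharf charp); apply: contraL ip => /dvdn_leq.
by rewrite -leqNgt => ->.
Qed.

Lemma unit_inj_pow_p u : iota (mul_pow mul p u) = iota u ^+ p.
Proof. by have := prime_gt0 (pcharf_prime charp); case: p => // q _; rewrite unit_inj_pow. Qed.

Lemma unit_inj_jacobson_s i u v : (0 < i < p)%N ->
  iota (jacobson_s p (commutator mul) i u v) =
  (((iota u)%:P * 'X + (iota v)%:P) ^+ p)`_i.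
Proof.
move=> ip; have i0 := natk_neq0 ip; apply: (unitization_MnI i0) => /=.
rewrite -unit_injMn -scaler_nat scalerA mulfV // scale1r unit_inj_iter_bracket.
case: i ip i0 => // i _ _; rewrite coef_affine_exp_pchar //.
exact: unitization_pchar.
Qed.

Lemma commutator_restricted : restricted_lie_algebra p (commutator mul) (mul_pow mul p).
Proof.
have charE := unitization_pchar charp.
have pp := prime_gt0 (pcharf_prime charp).
split; first exact: commutator_lie.
- move=> c u; case: p pp => // q _; elim: q => [|q IHq]; first by rewrite expr1.
  by rewrite !mul_powS IHq algZl algZr scalerA -exprS.
- move=> u v; apply: unit_inj_inj.
  by rewrite unit_inj_commutator unit_inj_pow_p commutator_expr_pchar // unit_inj_iter_ad.
move=> u v; apply: unit_inj_inj.
rewrite unit_inj_pow_p unit_injD expr_affine_sum !unit_injD !unit_inj_pow_p unit_inj_sum.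
(* The coefficients of degree p and 0 are u^p and v^p; those in between are the s_i. *)
rewrite big_ord_recr lead_affine_exp /= addrC -addrA; congr (_ + _).
rewrite -(big_mkord xpredT (nth 0 (polyseq (_ ^+ p)))) big_ltn // coef0_affine_exp.
by congr (_ + _); apply: eq_big_nat => i ip; rewrite unit_inj_jacobson_s.
Qed.

(* Evaluates ((t u + v)^p - v^p) / t at t = c. *)
Lemma star_power_pchar (c : k) (u v : A) (w : nat -> A) :
  w 1 = u ->
  (forall n, w n.+2 = mul v (w n.+1) + mul u (mul_pow mul n.+1 v) + c *: mul u (w n.+1)) ->
  w p = c ^+ p.-1 *: mul_pow mul p u +
    \sum_(1 <= r < p) c ^+ r.-1 *: jacobson_s p (commutator mul) r u v.
Proof.
move=> w1 wS; pose Y := (iota u)%:P * 'X + (iota v)%:P.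
(* Weighting degree i+1 by c^i performs the division by t; (c^i, 0) is the central copy of c^i in
   E. *)
have wE n : iota (w n.+1) = \sum_(i < n.+1) ((c ^+ i, 0) : E) * (Y ^+ n.+1)`_i.+1.
  elim: n => [|n IHn].
    by rewrite w1 big_ord_recl big_ord0 addr0 expr0 mul1r expr1 coef_affine.
  under eq_bigr do rewrite coefS_affine_expS mulrDr.
  (* In the sum with left factor v, the top term has degree n+2 in Y^(n+1) and vanishes. In the sum
     with left factor u, the term i = 0 is u v^(n+1) and the others give c u w_(n+1). *)
  rewrite big_split /= [X in _ = _ + X]big_ord_recr /=.
  rewrite [(Y ^+ n.+1)`_n.+2]nth_default ?size_affine_exp // !mulr0 addr0.
  rewrite big_ord_recl expr0 mul1r coef0_affine_exp wS !unit_injD !unit_injM unit_inj_pow.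
  rewrite unit_injZ unit_injM IHn -[LHS]addrA [LHS]addrC.
  congr (_ + _ + _); rewrite !mulr_sumr; apply: eq_bigr => i _.
    rewrite lift0 [c ^+ i.+1]exprS -unit_scalarM -!mulrA.
    by congr (_ * _); rewrite !mulrA unit_scalar_comm.
  by rewrite !mulrA unit_scalar_comm.
have pp := prime_gt0 (pcharf_prime charp).
apply: unit_inj_inj; rewrite unit_injD unit_injZ unit_inj_pow_p unit_inj_sum.
rewrite big_add1 -{1 2}(prednK pp) wE big_ord_recr addrC /= prednK // lead_affine_exp.
congr (_ + _); rewrite big_mkord; apply: eq_bigr => i _.
by rewrite unit_injZ unit_inj_jacobson_s //= -ltn_predRL.
Qed.
End Restricted.
End Unitization.

(** * Iterated brackets as weighted sums over compositions *)

Section CompositionSum.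
Variables (k : fieldType) (g : lmodType k) (br : g -> g -> g).
Hypothesis brL : lie_algebra br.
Variables (a x : g).

Lemma lie_brDl u v w : br (u + v) w = br u w + br v w.
Proof. by case: (lie_bilinear brL) => _ /(_ w) /(_ 1 u v); rewrite !scale1r. Qed.

Lemma lie_brDr u v w : br w (u + v) = br w u + br w v.
Proof. by case: (lie_bilinear brL) => /(_ w) /(_ 1 u v) + _; rewrite !scale1r. Qed.

Lemma lie_br0l w : br 0 w = 0.
Proof. by apply: (@addrI _ (br 0 w)); rewrite -lie_brDl !addr0. Qed.

Lemma lie_br0r w : br w 0 = 0.
Proof. by apply: (@addrI _ (br w 0)); rewrite -lie_brDr !addr0. Qed.

Lemma lie_brBr u v w : br w (u - v) = br w u - br w v.
Proof. by apply: (canRL (addrK _)); rewrite -lie_brDr subrK. Qed.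

Lemma lie_brMnr u w n : br w (u *+ n) = br w u *+ n.
Proof. by elim: n => [|n IHn]; rewrite ?lie_br0r // !mulrSr lie_brDr IHn. Qed.

Lemma lie_sumr (I : Type) (r : seq I) (Q : pred I) (F : I -> g) w :
  br w (\sum_(i <- r | Q i) F i) = \sum_(i <- r | Q i) br w (F i).
Proof. exact: (big_morph (br w) (fun u v => lie_brDr u v w) (lie_br0r w)). Qed.

Lemma lie_anti u v : br u v = - br v u.
Proof.
apply/eqP; rewrite -addr_eq0; apply/eqP.
have := lie_alternating brL (u + v).
by rewrite lie_brDl !lie_brDr !(lie_alternating brL) add0r addr0.
Qed.

Lemma lie_derivation w u v : br w (br u v) = br (br w u) v + br u (br w v).
Proof.
have /eqP := lie_jacobi brL w u v.
rewrite -addrA addr_eq0 => /eqP ->; rewrite opprD addrC.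
by rewrite -lie_anti [br v w]lie_anti -[in br u (- _)]sub0r lie_brBr lie_br0r sub0r opprK.
Qed.

Local Notation adx b := (iter b (br a) x).

(* [comp_sum r m n] is the sum over the compositions of [n] of length [r.+1] of
   the nested brackets of the [adx (alpha_j - 1)], weighted by
   \prod_j 'C(m + alpha_1 + .. + alpha_j - 1, alpha_j - 1). *)
Fixpoint comp_sum (r m n : nat) : g :=
  match r, n with
  | 0, n'.+1 => adx n' *+ 'C(m + n', n')
  | r'.+1, n'.+1 =>
     \sum_(b < n'.+1) br (adx b) (comp_sum r' (m + b.+1) (n' - b)) *+ 'C(m + b, b)
  | _, 0 => 0
  end.

Lemma comp_sumS r m n :
  comp_sum r.+1 m n = \sum_(b < n) br (adx b) (comp_sum r (m + b.+1) (n.-1 - b)) *+ 'C(m + b, b).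
Proof. by case: n => [|n] //=; rewrite big_ord0. Qed.

Lemma comp_sum0 r m : comp_sum r m 0 = 0.
Proof. by case: r. Qed.

(* Leibniz rule and Pascal's rule: the weights behave as if [m] were one more block. *)
Lemma ad_comp_sum r m n :
  br a (comp_sum r m.+1 n) = comp_sum r m.+1 n.+1 - comp_sum r m n.+1.
Proof.
elim: r m n => [|r IHr] m n.
  case: n => [|n]; first by rewrite lie_br0r /= !bin0 subrr.
  by rewrite /= lie_brMnr -iterS !addSn binS mulrnDr addrAC subrr add0r addnS.
rewrite comp_sumS lie_sumr.
under eq_bigr => b _.
  rewrite lie_brMnr lie_derivation -iterS addSn IHr lie_brBr mulrnDl.
  have -> : (n.-1 - b).+1 = (n - b)%N by case: n b => [[]|n b] //=; rewrite subSn // -ltnS.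
  over.
rewrite big_split /= -!/(comp_sum r.+1 _ _).
(* The added index b = n contributes 0, its tail being a sum over compositions of 0. *)
have -> : \sum_(b < n) (br (adx b) (comp_sum r (m + b.+1).+1 (n - b)) -
    br (adx b) (comp_sum r (m + b.+1) (n - b))) *+ 'C((m + b).+1, b) =
  \sum_(b < n.+1) (br (adx b) (comp_sum r (m + b.+1).+1 (n - b)) -
    br (adx b) (comp_sum r (m + b.+1) (n - b))) *+ 'C((m + b).+1, b).
  by rewrite big_ord_recr /= subnn !comp_sum0 subrr mul0rn addr0.
(* Here [br a] has lengthened the first block. After the shift of b, Pascal's rule turns the weight
   into a difference, which is 0 at b = 0. *)
have -> : \sum_(b < n) br (adx b.+1) (comp_sum r (m + b.+1).+1 (n.-1 - b)) *+ 'C((m + b).+1, b)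
  = \sum_(b < n.+1) br (adx b) (comp_sum r (m + b.+1) (n - b)) *+
    ('C((m + b).+1, b) - 'C(m + b, b)).
  rewrite [RHS]big_ord_recl /= !bin0 subnn mulr0n add0r.
  apply: eq_bigr => b _; rewrite /bump /= add1n add0n !addnS binS addKn.
  by case: n b => [[]|n b] //=; rewrite subSS.
rewrite -big_split -sumrB; apply: eq_bigr => b _ /=.
rewrite addSn mulrnBl addrCA; congr (_ + _).
(* Subtraction of weights is truncated, so the order of the binomials matters. *)
have le_C : ('C(m + b, b) <= 'C((m + b).+1, b))%N.
  by case: (val b) => [|b']; rewrite ?bin0 // binS leq_addr.
by rewrite mulrnBr // addrAC subrr add0r.
Qed.

(** For m = 0 the first block has weight 1. The two Leibniz sums cancel except for the missing index
    b = 0, that is, the compositions starting with a part 1. *)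
Lemma ad_comp_sum0 r n :
  br a (comp_sum r 0 n.+1) =
  comp_sum r 0 n.+2 - (if r is r'.+1 then br x (comp_sum r' 0 n.+1) else 0).
Proof.
case: r => [|r]; first by rewrite /= !add0n !binn subr0.
rewrite comp_sumS lie_sumr.
under eq_bigr => b _.
  rewrite lie_brMnr lie_derivation -iterS !add0n ad_comp_sum binn mulr1n lie_brBr.
  have -> : (n.+1.-1 - b).+1 = (n.+1 - b)%N by rewrite /= subSn // -ltnS.
  over.
rewrite big_split /=.
have E : \sum_(b < n.+1) br (adx b.+1) (comp_sum r b.+1 (n - b)) =
   \sum_(b < n.+2) br (adx b) (comp_sum r b (n.+1 - b)) - br x (comp_sum r 0 n.+1).
  by rewrite [X in _ = X - _]big_ord_recl /= subn0 addrAC subrr add0r.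
have -> : \sum_(b < n.+1) (br (adx b) (comp_sum r b.+1 (n.+1 - b)) -
    br (adx b) (comp_sum r b (n.+1 - b))) =
  \sum_(b < n.+2) (br (adx b) (comp_sum r b.+1 (n.+1 - b)) -
    br (adx b) (comp_sum r b (n.+1 - b))).
  by rewrite [RHS]big_ord_recr /= subnn !comp_sum0 subrr addr0.
rewrite {}E addrAC -big_split /=; congr (_ - _).
by apply: eq_bigr => b _; rewrite !add0n binn mulr1n addrC subrK.
Qed.

Lemma poly_bracket_affine (f : nat -> g) n :
  poly_bracket br (poly_affine x a) f n = br a (f n) + (if n is m.+1 then br x (f m) else 0).
Proof.
rewrite /poly_bracket big_ord_recl subn0; congr (_ + _).
case: n => [|n]; rewrite ?big_ord0 // big_ord_recl big1 ?addr0 => [|b _].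
  by rewrite /bump /= subSS subn0.
exact: lie_br0l.
Qed.

(** The exponent r of t counts the applications of [br x]; with the initial x this makes r+1 blocks.
    [ad_comp_sum0] is exactly the recursion between coefficients. *)
Lemma iter_poly_bracket n r :
  iter n (poly_bracket br (poly_affine x a)) (poly_const x) r = comp_sum r 0 n.+1.
Proof.
elim: n r => [|n IHn] r.
  case: r => [|r] //=; rewrite big_ord_recl big_ord0 subnn comp_sum0 lie_br0r.
  by rewrite mul0rn addr0.
rewrite iterS poly_bracket_affine IHn ad_comp_sum0.
by case: r => [|r]; rewrite ?subr0 ?addr0 // IHn subrK.
Qed.

(** At m = 0 this is [comp_coef]; in general m is the total of the parts already removed from the
    front. *)
Definition comp_weight (m : nat) (s : seq nat) : nat :=
  (\prod_(j < size s) 'C((m + sumn (take j.+1 s)).-1, (nth 0 s j).-1))%N.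

Lemma comp_weight_cons m b s :
  comp_weight m (b :: s) = ('C((m + b).-1, b.-1) * comp_weight (m + b) s)%N.
Proof.
rewrite /comp_weight /= big_ord_recl /= take0 /= addn0; congr (_ * _)%N.
by apply: eq_bigr => j _; rewrite /= addnA.
Qed.

Lemma is_composition_cons n b s :
  is_composition n (b.+1 :: s) = (b < n)%N && is_composition (n.-1 - b) s.
Proof.
rewrite /is_composition inE /= andbCA; congr (_ && _).
case: n => [|n] //=; rewrite addSn eqSS ltnS.
case: leqP => [le_bn|lt_nb]; first by rewrite -[in LHS](subnKC le_bn) eqn_add2l.
by apply/negbTE; rewrite gtn_eqF // ltn_addr.
Qed.

Lemma big_tuple_cons (I : finType) r (Q : pred (seq I)) (F : seq I -> g) :
  \sum_(t : r.+1.-tuple I | Q t) F t =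
  \sum_(b : I) \sum_(t : r.-tuple I | Q (b :: t)) F (b :: t).
Proof.
rewrite pair_big_dep /=.
rewrite (reindex (fun z : I * r.-tuple I => cons_tuple z.1 z.2)) //=.
exists (fun t : r.+1.-tuple I => (thead t, behead_tuple t)) => [[b t] _|t _] /=.
  by rewrite theadE; congr pair; apply: val_inj.
by case/tupleP: t => b t; apply: val_inj; rewrite /= theadE.
Qed.

(** Induction on the length, splitting off the first part; [n <= q] ensures that all parts of a
    composition of n lie in ['I_q.+1]. *)
Lemma comp_sum_tupleE q r m n : (n <= q)%N ->
  \sum_(t : r.+1.-tuple 'I_q.+1 | is_composition n (map val t))
    nested_bracket br (map (fun b => adx b.-1) (map val t)) *+ comp_weight m (map val t)
  = comp_sum r m n.
Proof.
elim: r m n => [|r IHr] m n le_nq.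
all: rewrite (big_tuple_cons _ (fun t => is_composition n (map val t)) (fun t => nested_bracket br
  (map (fun b => adx b.-1) (map val t)) *+ comp_weight m (map val t))).
(* A first part 0 is excluded, so the remaining indices stand for the parts b+1. *)
all: rewrite big_ord_recl big1 ?add0r; last by move=> t; rewrite /is_composition inE.
- under eq_bigr => b _.
    rewrite (eq_bigl (fun t : 0.-tuple 'I_q.+1 => n == b.+1)); last first.
      by move=> t; rewrite tuple0 /is_composition /= addn0 eq_sym /bump add1n.
    rewrite big_mkcond (big_pred1 [tuple]); last by move=> t; apply/esym/eqP; apply: tuple0.
    over.
  rewrite -big_mkcond /=; case: n le_nq => [|n] le_nq; first by rewrite big_pred0.
  rewrite (big_pred1 (Ordinal le_nq)); last by move=> b; rewrite eqSS eq_sym.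
  by rewrite /= /bump add1n comp_weight_cons /comp_weight big_ord0 muln1 addnS.
- rewrite comp_sumS (@big_ord_widen _ _ _ n q
    (fun b : nat => br (adx b) (comp_sum r (m + b.+1) (n.-1 - b)) *+ 'C(m + b, b)) le_nq).
  rewrite [RHS]big_mkcond; apply: eq_bigr => b _; rewrite /= /bump leq0n add1n.
  under eq_bigl do rewrite is_composition_cons.
  case: ifP => [lt_bn|_]; last by rewrite big_pred0.
  rewrite -IHr ?lie_sumr; last by rewrite (leq_trans (leq_subr _ _)) // (leq_trans (leq_pred n)).
  rewrite -sumrMnl; apply: eq_big => [t|t _]; first by rewrite ?lt_bn.
  rewrite comp_weight_cons addnS mulnC mulrnA lie_brMnr; congr (_ *+ _ *+ _).
  by case/tupleP: t.
Qed.

End CompositionSum.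

(** * Rota-Baxter operators and the twisted p-map *)

Lemma rb_algebra_commutator (k : fieldType) (lam : k) (A : lmodType k)
    (mul : A -> A -> A) (P : A -> A) :
  rb_algebra lam mul P -> rb_operator lam (commutator mul) P.
Proof.
case=> _ [Plin Prb]; split=> // x y.
have PB u v : P (u - v) = P u - P v.
  by rewrite -scaleN1r addrC Plin scaleN1r addrC.
rewrite /commutator !Prb !PB scalerBr 2!opprD addrACA; congr (_ + _).
by rewrite [- _ - _]addrC addrACA.
Qed.

(** With a = R x, the n-th [rhd_pow] of x is ad_a^(n-1) x, so the inner sum over compositions with r
    parts is r s_r(x, R x). *)
Lemma rb_pmapE (k : fieldType) (p : nat) (charp : p \in [pchar k]) (lam : k)
    (g : lmodType k) (br : g -> g -> g) (pmap R : g -> g) (x : g) :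
  lie_algebra br ->
  rb_pmap p lam br pmap R x =
  lam ^+ p.-1 *: pmap x +
  \sum_(1 <= r < p) lam ^+ r.-1 *: jacobson_s p br r x (R x).
Proof.
move=> brL; have pp := prime_gt0 (pcharf_prime charp).
congr (_ + _); apply: eq_big_nat => -[//|r] _.
rewrite /jacobson_s iter_poly_bracket // prednK // scalerA mulrC; congr (_ *: _).
rewrite -(comp_sum_tupleE brL (R x) x r 0 (leqnn p)).
by apply: eq_bigr => t _; rewrite scaler_nat.
Qed.

Lemma rb_algebra_restricted (k : fieldType) (p : nat) (charp : p \in [pchar k])
    (lam : k) (A : lmodType k) (mul : A -> A -> A) (P : A -> A) :
  rb_algebra lam mul P ->
  restricted_rb_lie_algebra p lam (commutator mul) (mul_pow mul p) P.
Proof.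
move=> rbA; have [algA [Plin Prb]] := rbA.
split; [exact: commutator_restricted | exact: rb_algebra_commutator |] => x.
have pp := prime_gt0 (pcharf_prime charp).
(* The powers of x for the product that P carries to [mul], starting from w 1 = x. *)
pose w n := iter n.-1 (fun z => mul (P x) z + mul x (P z) + lam *: mul x z) x.
have Pw n : P (w n.+1) = mul_pow mul n.+1 (P x).
  elim: n => [|n IHn] //; rewrite mul_powS -IHn Prb.
  rewrite -[w n.+2]/(mul (P x) (w n.+1) + mul x (P (w n.+1)) + lam *: mul x (w n.+1)).
  by rewrite [X in P X]addrC Plin -[X in P (X + _)]scale1r Plin scale1r addrC.
rewrite rb_pmapE //; last exact: commutator_lie.
rewrite -(@star_power_pchar _ _ _ algA _ charp lam x (P x) w) // => [|n].
  by rewrite -(prednK pp) Pw.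
(* Replacing P (w n.+1) by the power of P x turns the definition of w into the recursion of
   [star_power_pchar]. *)
by rewrite -Pw.
Qed.

Theorem corollary4p14 (k : closedFieldType) (p : nat) (hp : p \in [pchar k])
    (lam : k)
    (g : lmodType k) (br : g -> g -> g) (R : g -> g)
    (hg : rb_lie_algebra lam br R)
    (U : lmodType k) (mul : U -> U -> U) (P : U -> U) (i : g -> U)
    (hU : universal_enveloping_rb lam br R mul P i \/
          exists e : U, unital_universal_enveloping_rb lam br R mul e P i) :
  restricted_rb_lie_algebra p lam (commutator mul) (mul_pow mul p) P.
Proof. by case: hU => [[rbU _ _]|[e [rbU _ _ _]]]; apply: rb_algebra_restricted. Qed.
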